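(* Let $(X,d,\mu)$ be a coarse median space. Then $X$ has rank at most $1$ if and only if there exists a constant $\lambda$ such that for all $a,b,x\in X$ with $x\in[a,b]$, $$[a,b]\subseteq\mathcal N_\lambda([a,x])\cup\mathcal N_\lambda([x,b]).$$
   Context: Write $x\sim_s y$ if $d(x,y)\leqslant s$. A coarse median space is a triple $(X,d,\mu)$ with $(X,d)$ a metric space and $\mu\colon X^3\to X$ satisfying: (M1) $\mu(a,a,b)=a$; (M2) $\mu(a_1,a_2,a_3)$ is invariant under permutations of its arguments; (C1) there is an affine $\rho(t)=Kt+H_0$ with $d(\mu(a,b,c),\mu(a',b',c'))\leqslant\rho(d(a,a')+d(b,b')+d(c,c'))$ for all points; (C2) there is $H\colon\mathbb N\to[0,\infty)$ such that for every finite $A\subseteq X$ with $1\leqslant|A|\leqslant p$ there are a finite median algebra $(\Pi,\mu_\Pi)$ and maps $\pi\colon A\to\Pi$, $\lambda\colon\Pi\to X$ with $\lambda\mu_\Pi(x,y,z)\sim_{H(p)}\mu(\lambda x,\lambda y,\lambda z)$ for all $x,y,z\in\Pi$ and $\lambda\pi a\sim_{H(p)}a$ for all $a\in A$. (A median algebra is a set with a ternary operation $m$ satisfying $m(a,a,b)=a$, full symmetry, and $m(m(a,b,c),b,d)=m(a,b,m(c,b,d))$.) The rank of a median algebra is the supremum of $n$ such that it contains a subalgebra isomorphic to $I^n=(\mathbb Z_2)^n$ with coordinatewise majority vote as median. The coarse median space has rank at most $n$ if there exist $\rho,H$ as in (C1),(C2) for which $\Pi$ in (C2) can always be chosen of rank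 at most $n$. The interval is $[a,b]=\{\mu(a,y,b):y\in X\}$, and for $S\subseteq X$, $\mathcal N_\lambda(S)=\{y\in X:\exists s\in S,\ d(y,s)\leqslant\lambda\}$. *)

(* Defs.v *)
From Stdlib Require Import Reals List.
From mathcomp Require Import all_boot.
Set Implicit Arguments. Unset Strict Implicit. Unset Printing Implicit Defensive.

Open Scope R_scope.

Definition is_metric (X : Type) (d : X -> X -> R) : Prop :=
  (forall x y, 0 <= d x y) /\
  (forall x y, d x y = 0 <-> x = y) /\
  (forall x y, d x y = d y x) /\
  (forall x y z, d x z <= d x y + d y z).

Definition median_algebra (T : Type) (m : T -> T -> T -> T) : Prop :=
  (forall a b, m a a b = a) /\
  (forall a b c, m a b c = m b a c /\ m a b c = m a c b /\ m a b c = m c b a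
                 /\ m a b c = m b c a /\ m a b c = m c a b) /\
  (forall a b c d, m (m a b c) b d = m a b (m c b d)).

Definition cube (k : nat) := {ffun 'I_k -> bool}.

Definition majority (k : nat) (x y z : cube k) : cube k :=
  [ffun i => (x i && y i) || (y i && z i) || (x i && z i)].

Definition contains_cube (Pi : Type) (m : Pi -> Pi -> Pi -> Pi) (k : nat) : Prop :=
  exists f : cube k -> Pi, injective f /\
    forall x y z, f (majority x y z) = m (f x) (f y) (f z).

Definition rank_le (Pi : Type) (m : Pi -> Pi -> Pi -> Pi) (n : nat) : Prop :=
  forall k, contains_cube m k -> (k <= n)%N.

(** Axioms (M1),(M2),(C1),(C2) with explicit constants rho(t)=K t + H0 and H,
    where the finite median algebras of (C2) must moreover satisfy P.
    A finite subset A with 1 <= |A| <= p is given by a list of length in [1,p];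
    pi is given on all of X (only its values on A matter). *)
Definition coarse_median_axioms (X : Type) (d : X -> X -> R) (mu : X -> X -> X -> X)
  (K H0 : R) (H : nat -> R)
  (P : forall Pi : finType, (Pi -> Pi -> Pi -> Pi) -> Prop) : Prop :=
  (* M1 *) (forall a b, mu a a b = a) /\
  (* M2 *) (forall a b c, mu a b c = mu b a c /\ mu a b c = mu a c b /\
              mu a b c = mu c b a /\ mu a b c = mu b c a /\ mu a b c = mu c a b) /\
  (* C1 *) (forall a b c a' b' c',
              d (mu a b c) (mu a' b' c') <= K * (d a a' + d b b' + d c c') + H0) /\
  (* C2 *) (forall p, 0 <= H p) /\
  (forall (p : nat) (A : list X), (1 <= length A)%N -> (length A <= p)%N ->
     exists (Pi : finType) (mP : Pi -> Pi -> Pi -> Pi) (pi : X -> Pi) (lam : Pi -> X),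
       median_algebra mP /\ P Pi mP /\
       (forall x y z, d (lam (mP x y z)) (mu (lam x) (lam y) (lam z)) <= H p) /\
       (forall a, In a A -> d (lam (pi a)) a <= H p)).

Definition coarse_median_space (X : Type) (d : X -> X -> R) (mu : X -> X -> X -> X) : Prop :=
  is_metric d /\
  exists (K H0 : R) (H : nat -> R),
    coarse_median_axioms d mu K H0 H (fun _ _ => True).

Definition cm_rank_at_most (X : Type) (d : X -> X -> R) (mu : X -> X -> X -> X) (n : nat) : Prop :=
  exists (K H0 : R) (H : nat -> R),
    coarse_median_axioms d mu K H0 H (fun Pi mP => rank_le mP n).

Definition interval (X : Type) (mu : X -> X -> X -> X) (a b : X) : X -> Prop :=
  fun z => exists y, z = mu a y b.

Definition nbhd (X : Type) (d : X -> X -> R) (lam : R) (S : X -> Prop) : X -> Prop :=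
  fun y => exists s, S s /\ d y s <= lam.

(* Main.v *)
Require Import Defs.
From Stdlib Require Import Reals List.
From mathcomp Require Import all_boot.
From Stdlib Require Import Lra Classical.
Open Scope R_scope.
Set Implicit Arguments. Unset Strict Implicit. Unset Printing Implicit Defensive.

(** If [Pi] has rank at most 1 then two points [x], [z] of an interval [[a, b]] satisfy
    [z] in [[a, x]] or [z] in [[x, b]]: otherwise [m a x z], [x], [m b x z], [z] form a
    square.  Thinness of intervals of [X] follows by approximating four points.

    Conversely, thin intervals force every square of an approximating finite median
    algebra [Pi] to have a side that is short in [X].  Collapsing all walls crossed by that
    side yields a smaller median algebra that still approximates, with a controlled loss,
    and iterating removes all squares.  The number of iterations depends only on the
    number [p] of points, because a median algebra generated by [p] points has at most
    [2 ^ 2 ^ p] elements.  Both steps rest on the fact that homomorphisms to [bool]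
    separate the points of a finite median algebra. *)

(** * Intervals, gates and squares in a median algebra *)

Section MedianAlgebra.
Variables (T : Type) (m : T -> T -> T -> T).
Hypothesis Hm : median_algebra m.

Lemma med_idl a b : m a a b = a.
Proof. by case: Hm. Qed.

Lemma medC a b c : m a b c = m c b a.
Proof. by case: Hm => _ [/(_ a b c) [_ [_ []]]]. Qed.

Lemma medCl a b c : m a b c = m b a c.
Proof. by case: Hm => _ [/(_ a b c) []]. Qed.

Lemma medA a b c d : m (m a b c) b d = m a b (m c b d).
Proof. by case: Hm => _ []. Qed.

Lemma medCr a b c : m a b c = m a c b.
Proof. by case: Hm => _ [/(_ a b c) [_ []]]. Qed.

Lemma med_idr a b : m a b b = b.
Proof. by rewrite medC med_idl. Qed.

Lemma med_idm a b : m a b a = a.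
Proof. by rewrite medCr med_idl. Qed.

(* [btw a u b]: [u] lies in the interval [[a, b]].  With [b] fixed, [u, v |-> m u b v]
   is a semilattice with least element [b], whose order is [btw b]. *)
Definition btw a u b := m a u b = u.

Lemma btw_sym a u b : btw a u b -> btw b u a.
Proof. by rewrite /btw medC. Qed.

Lemma btw_med a b u : btw a (m a u b) b.
Proof. by rewrite /btw (medCl a (m _ _ _)) (medCl a u) medA med_idm. Qed.

Lemma btw_trans a u v w : btw a u v -> btw a v w -> btw a u w.
Proof.
rewrite /btw !(medCl a) => uv vw.
by rewrite -{1}uv medA vw.
Qed.

Lemma btw_anti a u v : btw a u v -> btw a v u -> u = v.
Proof. by rewrite /btw !(medCl a) => uv vu; rewrite -[LHS]uv medC. Qed.

Lemma btw_glb a u v w : btw a u v -> btw a u w -> btw a u (m v a w).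
Proof. by rewrite /btw !(medCl a) => uv uw; rewrite -medA uv. Qed.

Lemma btw_left a u v b : btw a v b -> btw a u v -> btw u v b.
Proof.
rewrite /btw => vb uv.
by rewrite -{1}uv [m a u v]medCr [m a v u]medC medA vb med_idr.
Qed.

Lemma btw_eq a u : btw a u a -> u = a.
Proof. by rewrite /btw med_idm. Qed.

(** With [s] the median, [p] lies in [[s, a]] and in [[s, b]], hence in [[s, m a s b]], which is the
    single point [s]. *)
Lemma med_unique a b c p : btw a p b -> btw b p c -> btw a p c -> m a b c = p.
Proof.
move=> pab pbc pac; set s := m a b c.
have ap : btw a p s by rewrite /s medCl; apply: btw_glb.
have bp : btw b p s by rewrite /s; apply: btw_glb => //; apply: btw_sym.
have sab : btw a s b by rewrite /s medCr; apply: btw_med.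
have := btw_glb (btw_sym ap) (btw_sym bp).
by rewrite [m a s b]sab => /btw_eq.
Qed.

(** [p] is the gate of [x] in [[a, b]]. The point [t] also projects to [p], so [w] is the median of
    [q], [a] with either one; this puts [t] and [p] each between [w] and the other. *)
Lemma btw_gate a b x q : btw a q b -> btw x (m a b x) q.
Proof.
move=> qab; set p := m a b x; set t := m x p q.
have pax : btw a p x by apply: btw_med.
have pbx : btw b p x by rewrite /p medCl; apply: btw_med.
have pab : btw a p b by rewrite /p medCr; apply: btw_med.
have txp : btw x t p by rewrite /t medCr; apply: btw_med.
have tpq : btw p t q by rewrite /t medCl; apply: btw_med.
have pta : btw t p a by apply: btw_left txp; apply: btw_sym.
have ptb : btw t p b by apply: btw_left txp; apply: btw_sym.
have tE : m b a t = p by apply: med_unique; apply: btw_sym.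
set w := m q a p.
have wE : w = m q a t by rewrite /w -tE -medA; congr (m _ a _); rewrite medCl; exact: qab.
have wap : btw a w p by rewrite /w medCl; apply: btw_med.
have wqt : btw q w t by rewrite wE; apply: btw_med.
have twp : btw w t p by apply: btw_left wqt; apply: btw_sym.
have pwt : btw w p t by apply: btw_left wap; apply: btw_sym.
by rewrite /btw -/t; apply: btw_anti twp pwt.
Qed.

(** [y] lies between [x] and the gate of [x] in [[a, b]], and that gate lies between [x] and
    [m a b c]. *)
Lemma btw_med3 x y a b c : btw x y a -> btw x y b -> btw x y (m a b c).
Proof.
move=> ya yb; apply: (btw_trans (v := m a b x)).
  by rewrite medCr; apply: btw_glb.
by apply: btw_gate; rewrite medCr; apply: btw_med.
Qed.

Lemma med_btw_med a b x z : btw a x b -> m (m a x z) x (m b x z) = x.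
Proof.
move=> xab; rewrite [m b x z]medC !medA -[m z x (m z x b)]medA med_idm.
by rewrite [m z x b]medC -medA xab med_idl.
Qed.

(** A 4-cycle with diagonals [p], [q] and [x], [z]: each vertex lies between its neighbours.
    Degenerate cycles are allowed. *)
Definition square p x q z :=
  [/\ m p x q = x, m p z q = z, m x p z = p & m x q z = q].

Lemma square_of_btw a b x z : btw a x b -> btw a z b ->
  square (m a x z) x (m b x z) z.
Proof.
move=> xab zab; split.
- exact: med_btw_med.
- by rewrite ![m _ x z]medCr; apply: med_btw_med.
- by rewrite (medCl a); apply: btw_med.
- by rewrite (medCl b); apply: btw_med.
Qed.

End MedianAlgebra.

(** * Homomorphisms to the two-element median algebra *)

Definition maj3 (x y z : bool) := (x && y) || (y && z) || (x && z).

(** These are the walls of [Pi]: the fibres of each are complementary half-spaces, possibly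
    empty. *)
Definition homs (Pi : finType) (m : Pi -> Pi -> Pi -> Pi) : {set {ffun Pi -> bool}} :=
  [set f : {ffun Pi -> bool} |
    [forall x, forall y, forall z, f (m x y z) == maj3 (f x) (f y) (f z)]].

Lemma homsP (Pi : finType) (m : Pi -> Pi -> Pi -> Pi) (f : {ffun Pi -> bool}) :
  reflect (forall x y z, f (m x y z) = maj3 (f x) (f y) (f z)) (f \in homs m).
Proof.
rewrite inE; apply: (iffP forallP) => [H x y z | H x].
  by move/forallP: (H x) => /(_ y) /forallP /(_ z) /eqP.
by apply/forallP => y; apply/forallP => z; apply/eqP.
Qed.

(* A minimal nontrivial interval [[x, w]] inside [[x, y]] has only two points, and
   the gate map onto it is the separating homomorphism. *)
Lemma homs_separate (Pi : finType) (m : Pi -> Pi -> Pi -> Pi) (Hm : median_algebra m)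
  (x y : Pi) : x != y -> exists2 f, f \in homs m & f x != f y.
Proof.
move=> xy; pose I w := [set v | m x v w == v].
pose P := [pred w | (m x w y == w) && (w != x)].
have Py : P y by rewrite /= (med_idr Hm) eqxx eq_sym xy.
case: (@arg_minnP _ y P (fun w => #|I w|) Py) => w /andP [/eqP wy wx] wmin.
have two v : m x v w = v -> v = x \/ v = w.
  move=> vw; case: (eqVneq v x) => [-> | vx]; [by left | right].
  have Pv : P v by rewrite /= vx (btw_trans Hm vw wy) eqxx.
  have Ivw : I v \subset I w.
    by apply/subsetP => u; rewrite !inE => /eqP uv; rewrite (btw_trans Hm uv vw) eqxx.
  have IE : I v = I w by apply/eqP; rewrite eqEcard Ivw wmin.
  have : w \in I v by rewrite IE inE (med_idr Hm).
  rewrite inE => /eqP wv; exact: (btw_anti Hm vw wv).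
pose f := [ffun v => m x v w == w].
(* One fibre of [f] has [w] between [x] and its points, the other [x] between [w] and its points; by
   [btw_med3] each absorbs medians with two entries in it. *)
have fT v : f v <-> btw m x w v by rewrite ffunE /btw (medCr Hm); split=> /eqP.
have fF v : ~~ f v <-> btw m w x v.
  rewrite ffunE /btw (_ : m w x v = m x v w); last by rewrite (medC Hm) (medCl Hm).
  have [-> | ->] := two (m x v w) (btw_med Hm x w v).
    by split=> // _; rewrite eq_sym.
  by rewrite eqxx; split=> // /eqP; rewrite (negPf wx).
have mT a b c : f a -> f b -> f (m a b c).
  by move=> /fT fa /fT fb; apply/fT; apply: btw_med3.
have mF a b c : ~~ f a -> ~~ f b -> ~~ f (m a b c).
  by move=> /fF fa /fF fb; apply/fF; apply: btw_med3.
exists f.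
  apply/homsP => a b c.
  case fa: (f a); case fb: (f b); case fc: (f c); rewrite /maj3 /=.
  - exact: mT.
  - exact: mT.
  - by rewrite (medCr Hm); exact: mT.
  - by apply/negbTE; rewrite (medCl Hm) (medCr Hm); apply: mF; rewrite ?fb ?fc.
  - by rewrite (medCl Hm) (medCr Hm); exact: mT.
  - by apply/negbTE; rewrite (medCr Hm); apply: mF; rewrite ?fa ?fc.
  - by apply/negbTE; apply: mF; rewrite ?fa ?fb.
  - by apply/negbTE; apply: mF; rewrite ?fa ?fb.
rewrite !ffunE (med_idl Hm) (medCr Hm) (_ : m x w y = w) // eqxx.
by rewrite (negPf (_ : x != w)) // eq_sym.
Qed.

(** * Squares and rank one *)

Lemma med_perms (T : Type) (m : T -> T -> T -> T) (Hm : median_algebra m) u v w r :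
  m u v w = r -> (m u v w = r) * (m v u w = r) * (m u w v = r) *
                 (m w v u = r) * (m v w u = r) * (m w u v = r).
Proof. by case: Hm => _ [/(_ u v w) [-> [-> [-> [-> ->]]]] _] ->. Qed.

(** Any coincidence of two vertices forces [z = p] or [z = q], so two inequalities give
    injectivity. *)
Lemma square_contains_cube (T : Type) (m : T -> T -> T -> T) (Hm : median_algebra m)
  p x q z : square m p x q z -> z <> p -> z <> q -> contains_cube m 2.
Proof.
case=> Ex Ez Ep Eq zp zq.
have xz : x <> z by move=> E; apply: zp; rewrite -Ep E (med_idm Hm).
have px : p <> x by move=> E; apply: zq; rewrite -Eq -{1}Ez E (medCr Hm).
have qx : q <> x by move=> E; apply: zp; rewrite -Ep -{1}Ez E (medC Hm) (medCr Hm).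
have pq : p <> q by move=> E; apply: px; rewrite -Ex E (med_idm Hm).
pose i0 : 'I_2 := ord0; pose i1 : 'I_2 := ord_max.
pose f (c : cube 2) := if c i0 then (if c i1 then q else x) else (if c i1 then z else p).
exists f; split.
  move=> c c' E; apply/ffunP => i.
  have H : c i0 = c' i0 /\ c i1 = c' i1.
    by move: E; rewrite /f; case: (c i0); case: (c i1); case: (c' i0); case: (c' i1) => // E;
      exfalso; auto.
  case: H => H0 H1; case: i => [[|[|//]] hi].
    by rewrite (_ : Ordinal hi = i0) //; apply: val_inj.
  by rewrite (_ : Ordinal hi = i1) //; apply: val_inj.
move=> a b c; rewrite /f /majority !ffunE.
have [Px [Pz [Pp Pq]]] := (med_perms Hm Ex, (med_perms Hm Ez, (med_perms Hm Ep, med_perms Hm Eq))).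
by case: (a i0); case: (a i1); case: (b i0); case: (b i1); case: (c i0); case: (c i1) => /=;
  rewrite ?(med_idl Hm) ?(med_idr Hm) ?(med_idm Hm) ?Px ?Pz ?Pp ?Pq.
Qed.

Lemma rank_le1_btw (T : Type) (m : T -> T -> T -> T) (Hm : median_algebra m) a b x z :
  rank_le m 1 -> m a x b = x -> m a z b = z -> m a z x = z \/ m x z b = z.
Proof.
move=> r1 xab zab.
case: (classic (m a x z = z)) => [E | zp]; first by left; rewrite (medCr Hm).
case: (classic (m b x z = z)) => [E | zq].
  by right; rewrite (medC Hm) (medCr Hm).
by have := r1 2%N (square_contains_cube Hm (square_of_btw Hm xab zab) (not_eq_sym zp) (not_eq_sym zq)).
Qed.

Lemma rank_gt1_square (T : Type) (m : T -> T -> T -> T) :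
  ~ rank_le m 1 -> exists p x q z, [/\ square m p x q z, z <> p & z <> q].
Proof.
move=> r1; have [k [[f [finj fm]] k1]] : exists k, contains_cube m k /\ (1 < k)%N.
  apply: NNPP => H; apply: r1 => k ck.
  by rewrite leqNgt; apply/negP => k1; apply: H; exists k.
case: k k1 f finj fm => [|[|k]] // _ f finj fm.
(* A 2-face of the cube: all coordinates after the first two are [false]. *)
pose e b c : cube k.+2 := [ffun i => if i == ord0 then b else if (i == 1%N :> nat) then c else false].
have eM b c b' c' b'' c'' :
    m (f (e b c)) (f (e b' c')) (f (e b'' c'')) = f (e (maj3 b b' b'') (maj3 c c' c'')).
  rewrite -fm; congr f; apply/ffunP => i; rewrite !ffunE.
  by case: (i == ord0); case: (i == 1%N :> nat).
exists (f (e false false)), (f (e true false)), (f (e true true)), (f (e false true)).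
split; first by split; rewrite eM.
  by move/finj/ffunP/(_ (inord 1)); rewrite !ffunE -val_eqE /= inordK.
by move/finj/ffunP/(_ ord0); rewrite !ffunE.
Qed.

(** * Quotients and finitely generated subalgebras *)

Section Quotient.
Variables (Pi : finType) (m : Pi -> Pi -> Pi -> Pi) (Hm : median_algebra m).

Lemma homs_ext x y : (forall f, f \in homs m -> f x = f y) -> x = y.
Proof.
move=> H; apply/eqP; apply: contraT => /(homs_separate Hm) [f fm].
by rewrite (H _ fm) eqxx.
Qed.

Lemma median_algebra_surj (T : Type) (m' : T -> T -> T -> T) (q : Pi -> T) (sec : T -> Pi) :
  cancel sec q -> (forall x y z, q (m x y z) = m' (q x) (q y) (q z)) -> median_algebra m'.
Proof.
move=> secK qm; split; [|split].
- by move=> a b; rewrite -[a]secK -[b]secK -qm (med_idl Hm).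
- move=> a b c; rewrite -[a]secK -[b]secK -[c]secK -!qm.
  by case: Hm => _ [/(_ (sec a) (sec b) (sec c)) [<- [<- [<- [<- <-]]]] _].
- by move=> a b c d; rewrite -[a]secK -[b]secK -[c]secK -[d]secK -!qm (medA Hm).
Qed.

(* The kernel of the quotient is cut out by the homomorphisms that identify [u] and [v]:
   points identified with each other differ only along walls that separate [u] from [v]. *)
Lemma collapse u v : u <> v ->
  exists (Pi' : finType) (m' : Pi' -> Pi' -> Pi' -> Pi') (q : Pi -> Pi') (sec : Pi' -> Pi),
    [/\ median_algebra m', cancel sec q, (#|Pi'| < #|Pi|)%N,
        forall x y z, q (m x y z) = m' (q x) (q y) (q z)
      & forall x y, q x = q y -> m x y (m x u v) = x].
Proof.
move=> uv.
pose ev x : {set {ffun Pi -> bool}} := [set f in homs m | (f u == f v) && f x].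
have evP x y : ev x = ev y <-> forall f, f \in homs m -> f u = f v -> f x = f y.
  split=> [/setP E f fm fuv | H].
    by have := E f; rewrite !inE; rewrite inE in fm; rewrite fm fuv eqxx.
  apply/setP => f; rewrite !(in_set (fun f => (f \in homs m) && _)).
  case fm: (f \in homs m) => //=.
  by case: eqP => //= fuv; rewrite (H f).
(* [r] picks one representative per class of [ev]; the default never occurs, since [x] itself
   qualifies. The quotient is the set of fixed points of [r]. *)
pose r x := odflt x [pick y | ev y == ev x].
have evr x : ev (r x) = ev x by rewrite /r; case: pickP => [y /eqP|].
have rev x y : ev x = ev y -> r x = r y.
  move=> E; rewrite /r.
  rewrite (eq_pick (Q := fun z => ev z == ev y)); last by move=> z; rewrite /= E.
  by case: pickP => // /(_ y); rewrite eqxx.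
have rr x : r (r x) == r x by apply/eqP/rev/evr.
pose Pi' : finType := {x | r x == x}.
pose q x : Pi' := exist _ (r x) (rr x).
have secK : cancel (fun x : Pi' => val x) q.
  by move=> [x xr]; apply: val_inj => /=; apply/eqP.
have qP x y : q x = q y <-> ev x = ev y.
  split; last by move=> E; apply: val_inj; apply: rev.
  by move/(congr1 val) => /= E; rewrite -(evr x) E evr.
pose m' (x y z : Pi') := q (m (val x) (val y) (val z)).
have qm x y z : q (m x y z) = m' (q x) (q y) (q z).
  apply/qP/evP => f fm fuv; rewrite /= !(homsP _ _ fm).
  by rewrite !(proj1 (evP _ _) (evr _) f fm fuv).
exists Pi', m', q, (fun x : Pi' => val x); split => //.
- exact: median_algebra_surj secK qm.
- rewrite -(card_codom (can_inj secK)).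
  apply: (leq_ltn_trans (n := #|[set x | r x == x]|)).
    apply: subset_leq_card; apply/subsetP => _ /codomP [[x xr] ->] /=.
    by rewrite inE.
  rewrite -cardsT; apply: proper_card; rewrite properT.
  apply/eqP => E.
  have Ev w : w = r w by apply/esym/eqP; have := in_setT w; rewrite -E inE.
  by apply: uv; rewrite (Ev u) (Ev v); apply: rev; apply/evP.
(* Checked on each homomorphism: if [f u = f v] then [f x = f y], and otherwise
   [f (m x u v) = f x]. *)
- move=> x y /qP/evP E; apply: homs_ext => f fm; rewrite !(homsP _ _ fm).
  have := E f fm; case: (f u); case: (f v); case: (f x); case: (f y) => //= H;
    by have := H erefl.
Qed.

Lemma generated p (s : 'I_p -> Pi) :
  exists G : {set Pi}, [/\ forall i, s i \in G,
    forall x y z, x \in G -> y \in G -> z \in G -> m x y z \in G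
    & (#|G| <= 2 ^ 2 ^ p)%N].
Proof.
pose closed (B : {set Pi}) :=
  [forall i, s i \in B] &&
  [forall x in B, forall y in B, forall z in B, m x y z \in B].
have closedP (B : {set Pi}) : reflect ((forall i, s i \in B) /\
   forall x y z, x \in B -> y \in B -> z \in B -> m x y z \in B) (closed B).
  apply: (iffP andP) => -[H1 H2]; split.
  - exact/forallP.
  - move=> x y z xB yB zB; have /forall_inP /(_ x xB) /forall_inP /(_ y yB) := H2.
    by move/forall_inP/(_ z zB).
  - exact/forallP.
  - by apply/forall_inP => x xB; apply/forall_inP => y yB; apply/forall_inP => z zB; auto.
pose G := \bigcap_(B | closed B) B.
have sG i : s i \in G by apply/bigcapP => B /closedP [].
have mG x y z : x \in G -> y \in G -> z \in G -> m x y z \in G.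
  move=> /bigcapP xG /bigcapP yG /bigcapP zG; apply/bigcapP => B cB.
  by case/closedP: (cB) => _; apply; auto.
exists G; split=> //.
(* The equalizer of [f] and [g] is closed, so it contains [G]. *)
have agree f g : f \in homs m -> g \in homs m -> (forall i, f (s i) = g (s i)) ->
    forall x, x \in G -> f x = g x.
  move=> fm gm fg x /bigcapP /(_ [set x | f x == g x]); rewrite inE => H.
  apply/eqP/H/closedP; split=> [i | a b c]; rewrite !inE ?fg //.
  by rewrite (homsP _ _ fm) (homsP _ _ gm) => /eqP -> /eqP -> /eqP ->.
(* A homomorphism on [G] is determined by its values on the generators, so a point of
   [G] is determined by the set of such value patterns whose homomorphism holds there. *)
pose pat x : {set {ffun 'I_p -> bool}} :=
  [set [ffun i => f (s i)] | f : {ffun Pi -> bool} in [set f in homs m | f x]].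
have patP f x : f \in homs m -> x \in G -> ([ffun i => f (s i)] \in pat x) = f x.
  move=> fm xG; apply/imsetP/idP => [[g] | fx]; last first.
    by exists f => //; rewrite in_set fm.
  rewrite in_set => /andP [gm gx] /ffunP E.
  by rewrite (agree f g) // => i; have := E i; rewrite !ffunE.
have inj : {in G &, injective pat}.
  move=> x y xG yG E; apply: homs_ext => f fm.
  by rewrite -(patP f x) // -(patP f y) // E.
rewrite -(card_in_imset inj) (leq_trans (max_card _)) //.
by rewrite -cardsT -powersetT card_powerset cardsT card_ffun card_bool card_ord.
Qed.

End Quotient.

(** * Estimates in a coarse median space *)

Definition approx (X : Type) (d : X -> X -> R) (mu : X -> X -> X -> X)
  (Pi : Type) (m : Pi -> Pi -> Pi -> Pi) (lam : Pi -> X) (h : R) :=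
  forall x y z, d (lam (m x y z)) (mu (lam x) (lam y) (lam z)) <= h.

Section Coarse.
Variables (X : Type) (d : X -> X -> R) (mu : X -> X -> X -> X) (K H0 : R) (H : nat -> R)
  (P : forall Pi : finType, (Pi -> Pi -> Pi -> Pi) -> Prop).
Hypothesis dX : is_metric d.
Hypothesis cmX : coarse_median_axioms d mu K H0 H P.

(** The bound from (C1) when each argument moves by at most [s]; absolute values are taken because
    [K] and [H0] have no prescribed sign. *)
Definition mod_cont s := Rabs K * (3 * s) + Rabs H0.
Local Notation L := mod_cont.

Lemma dist_ge0 x y : 0 <= d x y.
Proof. by case: dX. Qed.

Lemma dist_xx x : d x x = 0.
Proof. by case: dX => _ [/(_ x x) [_ ->]]. Qed.

Lemma dist_sym x y : d x y = d y x.
Proof. by case: dX => _ [_ []]. Qed.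

Lemma dist_tri y x z : d x z <= d x y + d y z.
Proof. by case: dX => _ [_ [_]]. Qed.

Lemma mu_idl a b : mu a a b = a.
Proof. by case: cmX. Qed.

Lemma muC a b c : mu a b c = mu c b a.
Proof. by case: cmX => _ [/(_ a b c) [_ [_ []]]]. Qed.

Lemma mod_cont_ge0 s : 0 <= s -> 0 <= L s.
Proof.
move=> s0; rewrite /L; have := Rabs_pos K; have := Rabs_pos H0 => ? ?.
by have := Rmult_le_pos (Rabs K) (3 * s); lra.
Qed.

Lemma mu_cont s a b c a' b' c' : d a a' <= s -> d b b' <= s -> d c c' <= s ->
  d (mu a b c) (mu a' b' c') <= L s.
Proof.
move=> da db dc.
have [_ [_ [/(_ a b c a' b' c') C1 _]]] := cmX.
apply: (Rle_trans _ _ _ C1); rewrite /L.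
set t := _ + _ + _; have t0 : 0 <= t.
  by rewrite /t; have := dist_ge0 a a'; have := dist_ge0 b b'; have := dist_ge0 c c'; lra.
have ts : t <= 3 * s by rewrite /t; lra.
have := RRle_abs K; have := RRle_abs H0; have := Rabs_pos K => ? ? ?.
have := Rmult_le_compat_r t K (Rabs K) t0.
have := Rmult_le_compat_l (Rabs K) t (3 * s).
by lra.
Qed.

Definition idem_const := 2 * (H 3 + L (H 3 + L (H 3))).

Lemma H_ge0 p : 0 <= H p.
Proof. by case: cmX => _ [_ [_ []]]. Qed.

(** The identity is exact in an algebra approximating [a], [y], [b]; both points are compared with
    [lam w], and the factor 2 absorbs the smaller of the two errors. *)
Lemma mu_idem a y b : d (mu a (mu a y b) b) (mu a y b) <= idem_const.
Proof.
have [_ [_ [_ [_ /(_ 3%N [:: a; y; b] erefl erefl)]]]] := cmX.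
move=> [Pi [m [pi [lam [Hm [_ [lm lp]]]]]]].
have pa : d (lam (pi a)) a <= H 3 by apply: lp => /=; auto.
have py : d (lam (pi y)) y <= H 3 by apply: lp => /=; auto.
have pb : d (lam (pi b)) b <= H 3 by apply: lp => /=; auto.
have h0 := H_ge0 3; have l0 := mod_cont_ge0 h0.
set w := m (pi a) (pi y) (pi b).
have w1 : d (lam w) (mu a y b) <= H 3 + L (H 3).
  have := dist_tri (mu (lam (pi a)) (lam (pi y)) (lam (pi b))) (lam w) (mu a y b).
  by have := lm (pi a) (pi y) (pi b); have := mu_cont pa py pb; rewrite -/w; lra.
have w2 : d (lam w) (mu a (mu a y b) b) <= H 3 + L (H 3 + L (H 3)).
  have wE : m (pi a) w (pi b) = w by apply: btw_med.
  have := lm (pi a) w (pi b); rewrite wE.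
  have pa' : d (lam (pi a)) a <= H 3 + L (H 3) by lra.
  have pb' : d (lam (pi b)) b <= H 3 + L (H 3) by lra.
  have := mu_cont pa' w1 pb'.
  by have := dist_tri (mu (lam (pi a)) (lam w) (lam (pi b))) (lam w) (mu a (mu a y b) b); lra.
have := dist_tri (lam w) (mu a (mu a y b) b) (mu a y b).
have l1 : 0 <= L (H 3 + L (H 3)) by apply: mod_cont_ge0; lra.
have : L (H 3) <= L (H 3 + L (H 3)).
  rewrite {1 2}/L; have := Rmult_le_compat_l (Rabs K) (3 * H 3) (3 * (H 3 + L (H 3))) (Rabs_pos K).
  by lra.
by rewrite [d _ (lam w)]dist_sym /idem_const; lra.
Qed.

(** * From thin intervals to rank at most one *)

Section Thin.
Variable lam0 : R.
Hypothesis lam0_ge0 : 0 <= lam0.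
Hypothesis thin : forall a b x, interval mu a b x -> forall z, interval mu a b z ->
  nbhd d lam0 (interval mu a x) z \/ nbhd d lam0 (interval mu x b) z.

(** Length of the chain [lam z], [z0], [s], [mu (lam e) s x0], [mu (lam e) (lam z) (lam x)], [lam e]
    in the next proof. *)
Definition side_const h := 2 * h + lam0 + idem_const + L (lam0 + h).

Section Approx.
Variables (Pi : finType) (m : Pi -> Pi -> Pi -> Pi) (lam : Pi -> X) (h : R).
Hypothesis Hm : median_algebra m.
Hypothesis lamP : approx d mu m lam h.

Lemma approx_ge0 (x : Pi) : 0 <= h.
Proof. by have := lamP x x x; have := dist_ge0 (lam (m x x x)) (mu (lam x) (lam x) (lam x)); lra. Qed.

(** [x0] and [z0] replace [lam x] and [lam z] by genuine points of an interval. Thinness puts [z0]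
    near one half of it, while in [Pi] the point [z] projects to [p] on [[p, x]] and to [q] on
    [[x, q]]. *)
Lemma square_short_side p x q z : square m p x q z ->
  d (lam z) (lam p) <= side_const h \/ d (lam z) (lam q) <= side_const h.
Proof.
case=> Ex Ez Ep Eq; have h0 := approx_ge0 p.
set a := lam p; set b := lam q.
set x0 := mu a (lam x) b; set z0 := mu a (lam z) b.
have dx : d x0 (lam x) <= h by have := lamP p x q; rewrite Ex dist_sym.
have dz : d z0 (lam z) <= h by have := lamP p z q; rewrite Ez dist_sym.
(* [z0] is close to a point [s] of an interval with endpoint [x0], and such a point is
   almost fixed by the projection to that interval, which sends [lam z] near [e]. *)
have close e s : m (e) z x = e -> d z0 s <= lam0 ->
    d (mu (lam e) s x0) s <= idem_const -> d (lam z) (lam e) <= side_const h.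
  move=> Ee zs si.
  have := lamP e z x; rewrite Ee => l1.
  have de : d (lam e) (lam e) <= lam0 + h by rewrite dist_xx; lra.
  have ds : d s (lam z) <= lam0 + h.
    by have := dist_tri z0 s (lam z); rewrite (dist_sym s z0); lra.
  have dx' : d x0 (lam x) <= lam0 + h by lra.
  have l2 := mu_cont de ds dx'.
  rewrite /side_const.
  have := dist_tri z0 (lam z) (lam e); rewrite (dist_sym (lam z) z0).
  have := dist_tri s z0 (lam e).
  have := dist_tri (mu (lam e) s x0) s (lam e); rewrite -?(dist_sym (mu (lam e) s x0) s).
  have := dist_tri (mu (lam e) (lam z) (lam x)) (mu (lam e) s x0) (lam e).
  rewrite (dist_sym (mu (lam e) (lam z) (lam x)) (lam e)); lra.
have [[s [[y sE] zs]] | [s [[y sE] zs]]] := thin (a := a) (b := b) (x := x0)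
  (ex_intro _ _ erefl) (ex_intro _ (lam z) erefl).
  left; apply: (close p s) => //; last by rewrite sE; apply: mu_idem.
  by rewrite (medC Hm) (medCr Hm).
right; apply: (close q s) => //; first by rewrite (medC Hm) (medCr Hm).
by rewrite muC sE; apply: mu_idem.
Qed.

Definition collapse_const h := 2 * (h + L (h + L (side_const h))).

(** Since [lam u] and [lam v] are close, [lam (m x u v)] is close to [lam u]. So [lam x], and
    likewise [lam y], is close to [mu (lam x) (lam y) (lam u)]. *)
Lemma collapse_close u v x y : d (lam u) (lam v) <= side_const h ->
  m x y (m x u v) = x -> m y x (m y u v) = y -> d (lam x) (lam y) <= collapse_const h.
Proof.
move=> uv; have h0 := approx_ge0 u.
have c0 : 0 <= side_const h by have := dist_ge0 (lam u) (lam v); lra.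
have half a b : m a b (m a u v) = a ->
    d (lam a) (mu (lam a) (lam b) (lam u)) <= h + L (h + L (side_const h)).
  move=> E.
  have dxx w s : 0 <= s -> d (lam w) (lam w) <= s by rewrite dist_xx.
  have l0 := mod_cont_ge0 c0.
  have g : d (lam (m a u v)) (lam u) <= h + L (side_const h).
    have := lamP a u v.
    have := mu_cont (dxx a _ c0) (dxx u _ c0) (s := side_const h) (c := lam v) (c' := lam u).
    rewrite (muC (lam a) (lam u) (lam u)) mu_idl dist_sym => /(_ uv).
    by have := dist_tri (mu (lam a) (lam u) (lam v)) (lam (m a u v)) (lam u); lra.
  have s0 : 0 <= h + L (side_const h) by lra.
  have := mu_cont (dxx a _ s0) (dxx b _ s0) g.
  have := lamP a b (m a u v); rewrite E.
  have := dist_tri (mu (lam a) (lam b) (lam (m a u v))) (lam a) (mu (lam a) (lam b) (lam u)).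
  by lra.
move=> /half hx /half; rewrite (_ : mu (lam y) (lam x) _ = mu (lam x) (lam y) (lam u)).
  move=> hy; have := dist_tri (mu (lam x) (lam y) (lam u)) (lam x) (lam y).
  by rewrite [d (mu _ _ _) (lam y)]dist_sym /collapse_const; lra.
by case: cmX => _ [/(_ (lam x) (lam y) (lam u)) [<-]].
Qed.

End Approx.

(** One collapse moves points by [collapse_const h] and raises the error to [collapse_const h + h];
    the maximum with [h] covers stopping early. *)
Fixpoint reduce_const n h :=
  if n is n'.+1 then
    Rmax h (reduce_const n' (collapse_const h + h) + collapse_const h)
  else h.

Lemma reduce_const_ge n h : h <= reduce_const n h.
Proof. by case: n => [|n] /=; [lra | apply: Rmax_l]. Qed.

Lemma rank1_reduction n : forall (Pi : finType) (m : Pi -> Pi -> Pi -> Pi) (lam : Pi -> X) h,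
  0 <= h -> median_algebra m -> (#|Pi| <= n)%N -> approx d mu m lam h ->
  exists (Pi' : finType) (m' : Pi' -> Pi' -> Pi' -> Pi') (q : Pi -> Pi') (lam' : Pi' -> X),
    [/\ median_algebra m', rank_le m' 1, approx d mu m' lam' (reduce_const n h)
      & forall x, d (lam' (q x)) (lam x) <= reduce_const n h].
Proof.
elim: n => [|n IH] Pi m lam h h0 Hm cardPi lamP; case: (classic (rank_le m 1)) => r1.
- exists Pi, m, id, lam; split=> // x; rewrite dist_xx //.
- have [p _] := rank_gt1_square r1.
  by have := fintype0 p; move: cardPi; rewrite leqn0 => /eqP E /(_ E).
- exists Pi, m, id, lam; split=> // [x y z | x].
    by have := lamP x y z; have := reduce_const_ge n.+1 h; lra.
  by rewrite dist_xx; have := reduce_const_ge n.+1 h; lra.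
have [u [v [uv duv]]] : exists u v, u <> v /\ d (lam u) (lam v) <= side_const h.
  have [p [x [q [z [sq zp zq]]]]] := rank_gt1_square r1.
  by have [D | D] := square_short_side Hm lamP sq; [exists z, p | exists z, q].
have [Pi1 [m1 [q1 [sec [Hm1 secK card1 qm qker]]]]] := collapse Hm uv.
have dq x y : q1 x = q1 y -> d (lam x) (lam y) <= collapse_const h.
  by move=> E; apply: (collapse_close lamP duv); apply: qker.
(* [sec (m1 x y z)] and the median of the sections lie in one class, which costs one
   [collapse_const h]. *)
have lamP1 : approx d mu m1 (lam \o sec) (collapse_const h + h).
  move=> x y z /=; have := lamP (sec x) (sec y) (sec z).
  have : q1 (sec (m1 x y z)) = q1 (m (sec x) (sec y) (sec z)) by rewrite qm !secK.
  move/dq; have := dist_tri (lam (m (sec x) (sec y) (sec z))) (lam (sec (m1 x y z)))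
    (mu (lam (sec x)) (lam (sec y)) (lam (sec z))).
  by lra.
have c0 : 0 <= collapse_const h by have := dq u u erefl; rewrite dist_xx.
have [||Pi2 [m2 [q2 [lam2 [Hm2 r2 lamP2 dq2]]]]] := IH _ m1 (lam \o sec) _ _ Hm1 _ lamP1.
- by lra.
- by rewrite -ltnS; apply: leq_trans card1 _.
exists Pi2, m2, (q2 \o q1), lam2.
have := Rmax_r h (reduce_const n (collapse_const h + h) + collapse_const h) => le.
split=> // [x y z | x] /=; first by have := lamP2 x y z; lra.
have := dq2 (q1 x) => /=; have : q1 (sec (q1 x)) = q1 x by rewrite secK.
by move/dq; have := dist_tri (lam (sec (q1 x))) (lam2 (q2 (q1 x))) (lam x); lra.
Qed.

Lemma thin_rank_le1 : cm_rank_at_most d mu 1.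
Proof.
exists K, H0, (fun p => reduce_const (2 ^ 2 ^ p) (H p) + H p).
have [M1 [M2 [C1 [Hp C2]]]] := cmX.
do 4?[split=> //].
  by move=> p; have := reduce_const_ge (2 ^ 2 ^ p) (H p); have := Hp p; lra.
move=> p A A1 Ap; have [Pi [m [pi [lam [Hm [_ [lm lp]]]]]]] := C2 p A A1 Ap.
case: A A1 Ap lp => // a0 A _ Ap lp.
(* Exactly [p] generators: indices past the end of the list repeat [pi a0]. *)
pose s (i : 'I_p) := pi (List.nth i (a0 :: A) a0).
have [G [sG mG cardG]] := generated Hm s.
pose PiG : finType := {x | x \in G}.
pose mPG (x y z : PiG) : PiG :=
  exist _ (m (val x) (val y) (val z)) (mG _ _ _ (valP x) (valP y) (valP z)).
have HmG : median_algebra mPG.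
  split; [|split].
  - by move=> a b; apply: val_inj; rewrite /= (med_idl Hm).
  - move=> a b c; case: Hm => _ [/(_ (val a) (val b) (val c)) [E1 [E2 [E3 [E4 E5]]]] _].
    by do 4?split; apply: val_inj.
  - by move=> a b c e; apply: val_inj; rewrite /= (medA Hm).
have piG a : In a (a0 :: A) -> pi a \in G.
  move=> /(In_nth _ _ a0) [i [/ltP ilt <-]].
  exact: (sG (Ordinal (leq_trans ilt Ap))).
pose g0 : PiG := exist _ (pi a0) (piG a0 (or_introl erefl)).
have cardPG : (#|PiG| <= 2 ^ 2 ^ p)%N by rewrite card_sig.
have [Pi' [m' [q [lam' [Hm' r1 lamP' dq]]]]] :=
  rank1_reduction (H_ge0 p) HmG cardPG (lam := lam \o val) (fun x y z => lm _ _ _).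
have h0 := Hp p.
(* The default [g0] only makes the map total; for [a] in the list, [pi a] is in [G]. *)
exists Pi', m', (fun a => q (insubd g0 (pi a))), lam'.
do 3?split=> //.
  by move=> x y z; have := lamP' x y z; lra.
move=> a aA; have := dq (insubd g0 (pi a)) => /=; rewrite val_insubd piG //.
by have := lp a aA; have := dist_tri (lam (pi a)) (lam' (q (insubd g0 (pi a)))) a; lra.
Qed.

End Thin.

End Coarse.

(** * From rank at most one to thin intervals *)

Lemma rank_le1_thin (X : Type) (d : X -> X -> R) (mu : X -> X -> X -> X) :
  is_metric d -> cm_rank_at_most d mu 1 ->
  exists lam : R, forall a b x : X, interval mu a b x ->
     forall z, interval mu a b z ->
       nbhd d lam (interval mu a x) z \/ nbhd d lam (interval mu x b) z.
Proof.
move=> dX [K [H0 [H cmX]]].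
pose L := mod_cont K H0; pose h := H 4%N; pose e := h + L h.
have h0 : 0 <= h := H_ge0 cmX 4%N.
have l0 : 0 <= L h := mod_cont_ge0 K H0 h0.
exists (e + h + L e) => a b x [yx xE] z [yz zE].
(* Approximating [yx] and [yz] rather than [x] and [z] yields medians [x'] and [z'] that lie exactly
   in the interval from [pi a] to [pi b], within [e] of [x] and [z]. *)
have [_ [_ [_ [_ /(_ 4%N [:: a; b; yx; yz] erefl erefl)]]]] := cmX.
move=> [Pi [m [pi [lam [Hm [r1 [lm lp]]]]]]].
have pa : d (lam (pi a)) a <= h by apply: lp => /=; auto.
have pb : d (lam (pi b)) b <= h by apply: lp => /=; auto.
have px : d (lam (pi yx)) yx <= h by apply: lp => /=; auto.
have pz : d (lam (pi yz)) yz <= h by apply: lp => /=; auto.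
have near w yw : d (lam (pi yw)) yw <= h -> w = mu a yw b ->
    d (lam (m (pi a) (pi yw) (pi b))) w <= e.
  move=> pw ->; have := mu_cont dX cmX pa pw pb; rewrite -/L.
  have := lm (pi a) (pi yw) (pi b); rewrite -/h.
  have := dist_tri dX (mu (lam (pi a)) (lam (pi yw)) (lam (pi b)))
    (lam (m (pi a) (pi yw) (pi b))) (mu a yw b).
  by rewrite /e; lra.
have nx := near x yx px xE; have nz := near z yz pz zE.
set x' := m _ _ _ in nx; set z' := m _ _ _ in nz.
have bound s t s' t' : d (lam s) s' <= e -> d (lam t) t' <= e -> m s z' t = z' ->
    d z (mu s' z t') <= e + h + L e.
  move=> ds dt E; have := mu_cont dX cmX ds nz dt; rewrite -/L.
  have := lm s z' t; rewrite E -/h.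
  have := dist_tri dX (mu (lam s) (lam z') (lam t)) (lam z') (mu s' z t').
  by have := dist_tri dX (lam z') z (mu s' z t'); rewrite (dist_sym dX z (lam z')); lra.
have pae : d (lam (pi a)) a <= e by rewrite /e; lra.
have pbe : d (lam (pi b)) b <= e by rewrite /e; lra.
have [E | E] := rank_le1_btw Hm r1 (btw_med Hm (pi a) (pi b) (pi yx))
  (btw_med Hm (pi a) (pi b) (pi yz)).
  by left; exists (mu a z x); split; [exists z | apply: bound E].
by right; exists (mu x z b); split; [exists z | apply: bound E].
Qed.

Theorem theorem4p4 (X : Type) (d : X -> X -> R) (mu : X -> X -> X -> X) :
  coarse_median_space d mu ->
  (cm_rank_at_most d mu 1 <->
   exists lam : R, forall a b x : X, interval mu a b x ->
     forall z, interval mu a b z ->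
       nbhd d lam (interval mu a x) z \/ nbhd d lam (interval mu x b) z).
Proof.
move=> [dX [K [H0 [H cmX]]]]; split; first exact: rank_le1_thin.
(* The given constant may be negative, so its absolute value is used. *)
move=> [lam thin]; apply: (thin_rank_le1 dX cmX (lam0 := Rabs lam) (Rabs_pos lam)).
have widen S z : nbhd d lam S z -> nbhd d (Rabs lam) S z.
  by move=> [s [Ss zs]]; exists s; split=> //; have := RRle_abs lam; lra.
by move=> a b x xab z zab; have [/widen | /widen] := thin a b x xab z zab; auto.
Qed.
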